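(* Let $D$ be a set whose cardinal $|D|$ is $\omega_1$-strongly compact and let $\kappa\geq\omega_0$ be an infinite cardinal. Then there exists a real-valued uniformly continuous function $f$ on the Baire space $(D^{\kappa},\pi)$, with $f(x)\neq 0$ for every $x\in D^{\kappa}$, such that the function $g=1/f$ cannot be continuously extended (as a real-valued function) to the Samuel realcompactification $H(U_\pi(D^{\kappa}))$.
   Context: A filter $\mathcal{F}$ is $\lambda$-complete ($\lambda\ge\omega_0$ a cardinal) if $\bigcap\mathcal{E}\in\mathcal{F}$ for every subfamily $\mathcal{E}\subset\mathcal{F}$ with $|\mathcal{E}|<\lambda$. A cardinal $\lambda>\omega_0$ is $\omega_1$-strongly compact if every $\lambda$-complete filter on any set $S$ can be extended to an $\omega_1$-complete ultrafilter on $S$. Baire space: $D$ carries the discrete uniformity (the partition into singletons is a uniform cover), and $D^{\kappa}$ is the product of $\kappa$ many copies of $D$ with the product uniformity $\pi$, which has as a base the partitions $\{\{x\}\times D^{\kappa\setminus N}: x\in D^N\}$, where $N$ runs over the finite subsets of $\kappa=\{\alpha:\alpha<\kappa\}$. Samuel realcompactification: for a uniform space $(X,\mu)$, $U_\mu(X)$ denotes the set of all real-valued uniformly continuous functions on $(X,\mu)$ ($\mathbb{R}$ with its usual Euclidean metric), and $wU_\mu(X)$ denotes the weak uniformity on $X$ induced by $U_\mu(X)$. The Samuel realcompactification $H(U_\mu(X))$ is the topological space underlying the completion of $(X,wU_\mu(X))$, which contains $X$ as a dense subspace. *)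

(* Defs.v *)
From HB Require Import structures.
From mathcomp Require Import all_boot all_order all_algebra.
From mathcomp Require Import all_classical all_reals all_analysis.

Set Implicit Arguments.
Unset Strict Implicit.
Unset Printing Implicit Defensive.

Import Order.TTheory GRing.Theory Num.Theory.
Import numFieldNormedType.Exports.

Local Open Scope classical_set_scope.
Local Open Scope card_scope.

(* Cardinals are represented by types: [L] stands for the cardinal |L|. *)

Definition card_lt (T U : Type) (A : set T) (B : set U) : Prop :=
  (A #<= B) /\ ~ (B #<= A).

(* When the subfamily [E] is empty, [\bigcap_(A in E) A] is the whole set. *)
Definition filter_complete (L T : Type) (F : set_system T) : Prop :=
  forall E : set_system T, E `<=` F -> card_lt E [set: L] ->
    F (\bigcap_(A in E) A).

(* The instance lambda = omega_1 of the previous notion: |E| < omega_1 means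
   that E is countable. *)
Definition omega1_filter_complete (T : Type) (F : set_system T) : Prop :=
  forall E : set_system T, E `<=` F -> countable E -> F (\bigcap_(A in E) A).

Definition omega1_strongly_compact (L : Type) : Prop :=
  ~ countable [set: L] /\
  forall (S : Type) (F : set_system S), ProperFilter F ->
    filter_complete L F ->
    exists U : set_system S,
      [/\ UltraFilter U, F `<=` U & omega1_filter_complete U].

(* Points are the minimal Cauchy filters; a basic entourage consists of the
   pairs of filters that share a V-small set. This is the Hausdorff completion;
   the lemmas below show that it is a complete Hausdorff uniform space in which
   X is dense and from which X inherits its uniformity. *)

Section completion.
Variable X : uniformType.

Definition minimal_cauchy (F : set_system X) : Prop :=
  [/\ ProperFilter F, cauchy F &
    forall G : set_system X, ProperFilter G -> cauchy G -> G `<=` F -> G = F].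

Definition completion : Type := {F : set_system X | minimal_cauchy F}.

HB.instance Definition _ := gen_eqMixin completion.
HB.instance Definition _ := gen_choiceMixin completion.

Definition share_small (V : set (X * X)) : set (completion * completion) :=
  [set FG | exists M, [/\ sval FG.1 M, sval FG.2 M & M `*` M `<=` V]].

Definition completion_ent : set_system (completion * completion) :=
  filter_from entourage share_small.

Lemma cauchy_smallP (F : set_system X) : Filter F ->
  cauchy F <-> forall V, entourage V -> exists2 M, F M & M `*` M `<=` V.
Proof.
move=> FF; split=> [cF V /cF|smF V /smF [M FM MV]]; last by exists (M, M).
move=> [[A B] /= [FA FB] ABV]; exists (A `&` B); first exact: filterI.
by move=> [a b] [[/= Aa _] [_ Bb]]; apply: ABV.
Qed.

Lemma completion_proper (F : completion) : ProperFilter (sval F).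
Proof. by have [] := svalP F. Qed.

Lemma completion_small (F : completion) (V : set (X * X)) : entourage V ->
  exists2 M, sval F M & M `*` M `<=` V.
Proof.
have [FF cF _] := svalP F; move=> entV.
by have /cauchy_smallP := cF; apply.
Qed.

Local Open Scope relation_scope.

Let completion_ent_filter : Filter completion_ent.
Proof.
apply: filter_from_filter; first by exists setT; exact: entourageT.
move=> V W entV entW; exists (V `&` W); first exact: filterI.
move=> [F G] [M [FM GM MVW]].
by split; exists M; split=> // ab /MVW [].
Qed.

Let completion_ent_refl A : completion_ent A -> diagonal `<=` A.
Proof.
move=> [V entV VA] [F G] /diagonalP <-; apply: VA.
by have [M FM MV] := completion_small F entV; exists M.
Qed.

Let completion_ent_inv A : completion_ent A -> completion_ent A^-1.
Proof.
move=> [V entV VA]; exists V => // -[F G] [M [FM GM MV]].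
by apply: VA; exists M.
Qed.

Lemma share_small_trans (V : set (X * X)) (F G H : completion) : entourage V ->
  share_small (split_ent V) (F, G) -> share_small (split_ent V) (G, H) ->
  share_small V (F, H).
Proof.
move=> entV [M [/= FM GM MW]] [N [/= GN HN NW]].
have FF := completion_proper F; have GG := completion_proper G.
have HH := completion_proper H.
have [c [Mc Nc]] := filter_ex (filterI GM GN).
exists (M `|` N); split=> /=.
- by apply: filterS FM => x; left.
- by apply: filterS HN => x; right.
- move=> [a b] [/= aMN bMN].
  apply: (@entourage_split _ c) => //.
  + by case: aMN => ?; [exact: MW|exact: NW].
  + by case: bMN => ?; [exact: MW|exact: NW].
Qed.

Let completion_ent_split A : completion_ent A ->
  exists2 B, completion_ent B & B \; B `<=` A.
Proof.
move=> [V entV VA]; exists (share_small (split_ent V)).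
  by exists (split_ent V) => //; exact: entourage_split_ent.
by move=> [F H] [G FG GH]; apply: VA; exact: share_small_trans FG GH.
Qed.

HB.instance Definition _ := isUniform.Build completion
  completion_ent_filter completion_ent_refl completion_ent_inv
  completion_ent_split.

Lemma completion_entE : @entourage completion = completion_ent.
Proof. by []. Qed.

Lemma nbhs_minimal_cauchy (x : X) : minimal_cauchy (nbhs x).
Proof.
split; first exact: nbhs_pfilter.
- apply/cauchy_smallP => V entV; set W := split_ent V.
  exists (xsection (W `&` W^-1) x).
    by apply: nbhs_entourage; apply: entourage_invI; exact: entourage_split_ent.
  move=> [a b] [/= /xsectionP[_ ax] /xsectionP[xb _]].
  exact: (@entourage_split _ x).
- move=> G GG /cauchy_smallP smG GX; apply/seteqP; split=> // A.
  move=> /nbhsP [V entV VA]; have [M GM MV] := smG V entV.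
  apply: filterS (GM) => y My; apply/VA/xsectionP/MV; split=> //=.
  by apply: nbhs_singleton; exact: GX.
Qed.

Definition to_completion (x : X) : completion :=
  exist _ (nbhs x) (nbhs_minimal_cauchy x).

Lemma completion_hausdorff : hausdorff_space completion.
Proof.
move=> F G clFG.
have small V : entourage V -> share_small V (F, G).
  move=> entV; set E := share_small (split_ent V).
  have entE : @entourage completion E.
    by exists (split_ent V) => //; exact: entourage_split_ent.
  have [H [/xsectionP FH /xsectionP [M [/= GM HM MW]]]] :=
    clFG _ _ (nbhs_entourage F entE) (nbhs_entourage G entE).
  by apply: (share_small_trans entV FH); exists M.
have [FF _ minF] := svalP F; have [GG _ minG] := svalP G.
pose I : set_system X := sval F `&` sval G.
have II : ProperFilter I.
  split; first by move=> [/filter_not_empty].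
  split; first by split; exact: filterT.
  - by move=> A B [? ?] [? ?]; split; exact: filterI.
  - by move=> A B AB [? ?]; split; apply: (filterS AB).
have cI : cauchy I.
  by apply/cauchy_smallP => V /small [M [? ? ?]]; exists M.
have IF : I = sval F by apply: minF => // A [].
have IG : I = sval G by apply: minG => // A [].
by apply: eq_sig_hprop => [A p q|]; [exact: Prop_irrelevance|rewrite -IF -IG].
Qed.

Lemma to_completion_entE :
  @entourage X = @initial_ent X completion to_completion.
Proof.
apply/seteqP; split=> [V entV|A [E [V entV VE] EA]].
  exists (share_small V); first by exists V.
  move=> [x y] [M [/= /nbhs_singleton Mx /nbhs_singleton My MV]].
  by apply: MV.
set W := split_ent V; set U := split_ent W.
have entW : entourage W by exact: entourage_split_ent.
have entU : entourage U by exact: entourage_split_ent.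
pose S := U `&` U^-1.
have entS : entourage S by exact: entourage_invI.
apply: filterS (entS) => -[x y] [Uxy Uyx]; apply/EA/VE.
exists (xsection (W `&` W^-1) x); split => /=.
- by apply: nbhs_entourage; exact: entourage_invI.
- apply: filterS (nbhs_entourage y entS) => z /xsectionP [Uyz Uzy].
  apply/xsectionP; split; first exact: (@entourage_split _ y).
  by rewrite -entourage_sym; apply: (@entourage_split _ y).
- move=> [a b] [/= /xsectionP[_ ax] /xsectionP[xb _]].
  exact: (@entourage_split _ x).
Qed.

Lemma to_completion_dense : dense (range to_completion).
Proof.
move=> O [F OF] oO.
have /nbhsP [E [V entV VE] EO] : nbhs F O by apply: open_nbhs_nbhs.
set W := split_ent V.
have entW : entourage W by exact: entourage_split_ent.
have FF := completion_proper F.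
have entS : entourage (W `&` W^-1) by exact: entourage_invI.
have [M FM MS] := completion_small F entS.
have [x Mx] := filter_ex FM.
exists (to_completion x); split; last by exists x.
apply/EO/xsectionP/VE; exists (xsection (W `&` W^-1) x); split=> /=.
- by apply: filterS FM => y My; apply/xsectionP/MS.
- exact: nbhs_entourage.
- move=> [a b] [/= /xsectionP[_ ax] /xsectionP[xb _]].
  exact: (@entourage_split _ x).
Qed.

Lemma minimal_cauchy_below (G : set_system X) : ProperFilter G -> cauchy G ->
  exists F : completion, sval F `<=` G.
Proof.
move=> GG /cauchy_smallP smG.
pose fat (VM : set (X * X) * set X) : set X :=
  [set y | exists2 x, VM.2 x & VM.1 (x, y)].
pose F : set_system X := filter_from (entourage `*` G) fat.
have fatM VM : entourage VM.1 -> VM.2 `<=` fat VM.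
  by move=> entV x Mx; exists x => //; exact: entourage_refl.
have FG : F `<=` G.
  by move=> A [VM [entV GM] VMA]; apply: filterS GM => x /(fatM _ entV)/VMA.
have FF : ProperFilter F.
  apply: filter_from_proper; last first.
    by move=> VM [entV /filter_ex [x Mx]]; exists x; exact: fatM.
  apply: filter_from_filter.
    by exists (setT, setT); split; [exact: entourageT|exact: filterT].
  move=> [V M] [W N] [/= entV GM] [/= entW GN].
  exists (V `&` W, M `&` N); first by split; exact: filterI.
  by move=> y [x [/= Mx Nx] [Vxy Wxy]]; split; exists x.
suff mF : minimal_cauchy F by exists (exist _ F mF).
split=> //.
- apply/cauchy_smallP => V entV; set W := split_ent V; set U := split_ent W.
  have entW : entourage W by exact: entourage_split_ent.
  have entU : entourage U by exact: entourage_split_ent.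
  have entS : entourage (U `&` U^-1) by exact: entourage_invI.
  have [M GM MU] := smG U entU.
  exists (fat (U `&` U^-1, M)); first by exists (U `&` U^-1, M).
  move=> [a b] [[x /= Mx [_ ax]] [y /= My [yb _]]].
  apply: (@entourage_split _ x) => //; first exact: split_ent_subset.
  by apply: (@entourage_split _ y) => //; exact: MU.
- move=> H HH /cauchy_smallP smH HF; apply/seteqP; split=> // A.
  move=> [[V M] [/= entV GM] VMA]; have [N HN NV] := smH V entV.
  have [x [Mx Nx]] := filter_ex (filterI GM (FG _ (HF _ HN))).
  by apply: filterS HN => y Ny; apply: VMA; exists x => //; exact: NV.
Qed.

Lemma completion_complete (P : set_system completion) : ProperFilter P ->
  cauchy P -> exists F : completion, P --> F.
Proof.
move=> PP cP; pose G : set_system X := [set A | P [set F | sval F A]].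
have GG : ProperFilter G.
  split.
    move=> G0; have [F F0] := filter_ex (G0 : P [set F | sval F set0]).
    have FF := completion_proper F; exact: (filter_not_empty (sval F)) F0.
  split.
  - by apply: (@filterE _ P) => F; have FF := completion_proper F; exact: filterT.
  - move=> A B GA GB.
    apply: (@filterS _ P) (@filterI _ P _ _ _ GA GB) => F [FA FB].
    by have FF := completion_proper F; exact: filterI.
  - move=> A B AB; apply: (@filterS _ P) => F /= FA.
    by have FF := completion_proper F; exact: filterS FA.
have cG : cauchy G.
  apply/cauchy_smallP => V entV; set W := split_ent V.
  have entW : entourage W by exact: entourage_split_ent.
  have entsW : @entourage completion (share_small W) by exists W.
  have [[Q R] /= [PQ PR] QRW] := cP _ entsW.
  have [F0 [QF0 RF0]] := filter_ex (filterI PQ PR).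
  have FF0 := completion_proper F0.
  exists (\bigcup_(M in [set M | sval F0 M /\ M `*` M `<=` W]) M).
    apply: (@filterS _ P) PR => F RF.
    have [M [/= F0M FM MW]] := QRW (F0, F) (conj QF0 RF).
    have FF := completion_proper F.
    by apply: (filterS _ FM) => x Mx; exists M.
  move=> [a b] [/= [M [F0M MW] Ma] [N [F0N NW] Nb]].
  have [c [Mc Nc]] := filter_ex (filterI F0M F0N).
  by apply: (@entourage_split _ c) => //; [exact: MW|exact: NW].
have [F FG] := minimal_cauchy_below GG cG; exists F.
apply/cvg_entourageP => E [V entV VE].
have [M FM MV] := completion_small F entV.
have PM : P [set H | sval H M] := FG _ FM.
by apply: filterS PM => H HM; apply: VE; exists M.
Qed.

End completion.

(* The uniformity of [{ptws K -> _}] is the product uniformity, here of copies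
   of D with the discrete uniformity. *)
Definition baire_space (D : choiceType) (K : Type) : uniformType :=
  {ptws K -> discrete_topology D}.

Definition unif_continuous_fun (R : realType) (X : uniformType) : Type :=
  {f : X -> R | unif_continuous f}.

Definition weak_uniformity (R : realType) (X : uniformType) : uniformType :=
  sup_topology (fun f : unif_continuous_fun R X =>
    Uniform.class (initial_topology (sval f))).

Definition samuel_realcompactification (R : realType) (X : uniformType) :
    topologicalType :=
  completion (weak_uniformity R X).

Definition to_samuel (R : realType) (X : uniformType) (x : X) :
    samuel_realcompactification R X :=
  @to_completion (weak_uniformity R X) x.

(* Main.v *)
Require Import Defs.
From HB Require Import structures.
From mathcomp Require Import all_boot all_order all_algebra.
From mathcomp Require Import all_classical all_reals all_analysis.
From mathcomp Require Import finmap lra.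
From mathcomp Require wochoice.
Import Order.TTheory GRing.Theory Num.Theory.
Import numFieldNormedType.Exports.
Local Open Scope classical_set_scope.
Local Open Scope ring_scope.

(* Suppose that omega_1-complete ultrafilters p_n on D^n are coherent under
   truncation and that p_n concentrates on the sequences that strictly descend
   for a well-order of D. Embed D^n into D^K, with coordinates indexed by a copy
   of nat in K. A uniformly continuous real function depends, up to epsilon, on
   finitely many coordinates, so by omega_1-completeness it converges along the
   p_n: they define a point of the Samuel realcompactification. Along them the
   place of the first failure of descent tends to infinity, although it is
   finite at every point of D^K; take f = 1 / (1 + that place).

   To find the p_n, let W be a well-order in which families indexed by
   ultrafilters are bounded, and extend a fine filter on the small subsets of W
   to an omega_1-complete ultrafilter U. This gives functions f_w into D and an
   operation next on W such that f_v < f_w U-almost everywhere whenever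
   next v < w. If the tree of the candidates for p_n, ordered by extension, were
   well-founded, one could map it into W by some psi with
   next (psi q) < psi p whenever q extends p. Starting from the root, the
   distributions under U of (f_(psi p_0), ..., f_(psi p_(n-1))) would then be an
   infinite branch p_n. *)

Set Implicit Arguments.
Unset Strict Implicit.

(** * Well-founded relations and well-orders *)

(** The last clause makes incomparability transitive. Trichotomy is not demanded, because different
    Brouwer ordinals may have the same height. *)
Definition weak_well_order (W : Type) (lt : W -> W -> Prop) : Prop :=
  [/\ well_founded lt, (forall x y z, lt x y -> lt y z -> lt x z) &
      forall x y z, lt x z -> lt x y \/ lt y z].

Lemma wf_minimal (W : Type) (lt : W -> W -> Prop) (A : set W) :
  well_founded lt -> A !=set0 -> exists2 m, A m & forall v, A v -> ~ lt v m.
Proof.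
move=> wf [x]; elim/(well_founded_ind wf): x => x IH Ax.
have [[y [Ay yx]]|nex] := pselect (exists y, A y /\ lt y x); first exact: IH Ay.
by exists x => // v Av vx; apply: nex; exists v.
Qed.

Lemma wf_irrefl (W : Type) (lt : W -> W -> Prop) (x : W) :
  well_founded lt -> ~ lt x x.
Proof.
by move=> wf; elim/(well_founded_ind wf): x => x IH lxx; exact: (IH _ lxx lxx).
Qed.

Lemma wf_no_descent (W : Type) (lt : W -> W -> Prop) (u : nat -> W) :
  well_founded lt -> ~ forall n, lt (u n.+1) (u n).
Proof.
move=> wf du; have [_ [n _ <-] min_n] :=
  wf_minimal wf (ex_intro (range u) (u 0%N) (ex_intro2 _ _ 0%N I erefl)).
by apply: (min_n (u n.+1)); [exists n.+1|exact: du].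
Qed.

Lemma not_Acc_descent (W : Type) (lt : W -> W -> Prop) (x : W) : ~ Acc lt x ->
  exists2 u : nat -> W, u 0%N = x & forall n, lt (u n.+1) (u n).
Proof.
move=> nx.
have step (y : {y | ~ Acc lt y}) :
    exists z : {y | ~ Acc lt y}, lt (sval z) (sval y).
  case: y => y ny /=; apply: contrapT => nz; apply: ny; constructor => z zy.
  apply: contrapT => nAz; apply: nz.
  by exists (exist (fun y => ~ Acc lt y) z nAz).
have [s sP] := choice step.
by exists (fun n => sval (iter n s (exist _ x nx))) => // n; exact: sP.
Qed.

(** The step [G] receives a total function, set to [y0] off the predecessors of [x]; extensionality
    then yields the recursion equation. *)
Lemma wf_recursion (X Y : Type) (R : X -> X -> Prop) (G : X -> (X -> Y) -> Y)
    (y0 : Y) : well_founded R ->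
  (forall x h h', (forall y, R y x -> h y = h' y) -> G x h = G x h') ->
  exists f : X -> Y, forall x, f x = G x f.
Proof.
move=> wf extG.
pose F x (rec : forall y, R y x -> Y) :=
  G x (fun y => if pselect (R y x) is left yx then rec y yx else y0).
exists (Fix wf (fun=> Y) F) => x; rewrite Fix_eq.
  by apply: extG => y yx; case: pselect.
by move=> z h h' hh'; apply: extG => y yz; case: pselect.
Qed.

Lemma exists_well_order (D : eqType) : exists2 lt : D -> D -> Prop,
  weak_well_order lt & forall x y, [\/ lt x y, x = y | lt y x].
Proof.
have [R woR] := wochoice.well_ordering_principle D.
have minR (A : set D) : A !=set0 -> exists2 z, A z & forall x, A x -> R z x.
  move=> [x Ax]; have [|z [[Az zmin] _]] := woR [pred x | `[< A x >]].
    by exists x; apply/asboolP.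
  by exists z => [|y Ay]; [exact/asboolP|apply: zmin; apply/asboolP].
have Rtot x y : R x y \/ R y x.
  have [|z [] -> zP] := minR [set x; y]; first by exists x; left.
    by left; apply: zP; right.
  by right; apply: zP; left.
have Rxx x : R x x by case: (Rtot x x).
have Ranti x y : R x y -> R y x -> x = y.
  move=> xy yx; have [|z [_ zU]] := woR [pred z | (z == x) || (z == y)].
    by exists x; rewrite inE eqxx.
  rewrite -(zU x) ?(zU y) //; split; rewrite ?inE ?eqxx ?orbT //.
    by move=> w; rewrite inE => /orP[]/eqP->.
  by move=> w; rewrite inE => /orP[]/eqP->.
have Rtr x y z : R x y -> R y z -> R x z.
  move=> xy yz; have [|w ww wP] := minR [set x; y; z].
    by exists x; do 2!left.
  have [wx wy wz] : [/\ R w x, R w y & R w z].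
    by split; apply: wP; [do 2!left|left; right|right].
  case: ww wx wy wz => [[]|] -> wx wy wz //; first by rewrite (Ranti x y).
  by rewrite -(Ranti y z).
exists (fun x y => R x y /\ x <> y) => [|x y].
  split=> [x|x y z [xy nxy] [yz nyz]|x y z [xz nxz]].
  - apply: contrapT => nx.
    have [z nz zP] := minR [set x | ~ Acc (fun x y => R x y /\ x <> y) x]
      (ex_intro _ x nx).
    apply: nz; constructor => y [yz nyz]; apply: contrapT => /zP zy.
    by apply: nyz; exact: Ranti.
  - split=> [|xz]; first exact: Rtr xy yz.
    by apply: nxy; apply: Ranti => //; rewrite xz.
  - have [xy|nxy] := eqVneq x y; first by right; split; rewrite -xy.
    have [xy|yx] := Rtot x y; first by left; split=> //; exact/eqP.
    right; split=> [|yz]; first exact: Rtr yx xz.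
    by apply: nxz; apply: Ranti => //; rewrite -yz.
have [->|/eqP nxy] := eqVneq x y; first exact: Or32.
by have [xy|yx] := Rtot x y; [apply: Or31|apply: Or33; split=> // /esym].
Qed.

(* r w is the least element of D outside { r v | v in c, v < w }. *)
Lemma rank_embedding (D : choiceType) (ltD : D -> D -> Prop) (d0 : D)
    (W : Type) (lt : W -> W -> Prop) (c : set W) :
  weak_well_order ltD -> (forall x y, [\/ ltD x y, x = y | ltD y x]) ->
  weak_well_order lt -> ~ ([set: D] #<= c)%card ->
  exists r : W -> D, forall v w, c v -> c w -> lt v w -> ltD (r v) (r w).
Proof.
move=> [wfD _ _] totD [wf tr _] nDc.
pose below (h : W -> D) w := h @` [set v | c v /\ lt v w].
pose least (A : set D) d := A d /\ forall e, A e -> ~ ltD e d.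
have [r rE] : exists r : W -> D, forall w, r w = xget d0 (least (~` below r w)).
  apply: (wf_recursion (G := fun w h => xget d0 (least (~` below h w))) d0 wf).
  move=> w h h' hh'; congr (xget _ (least (~` _))).
  by apply: eq_imagel => v [_ vw]; exact: hh'.
have rP w : c w -> least (~` below r w) (r w).
  move=> cw; have [d bd] : ~` below r w !=set0.
    apply/set0P/negP => /eqP/(congr1 (@setC D)); rewrite setCK setC0 => bT.
    apply: nDc; rewrite -bT; apply: card_le_trans (card_image_le _ _) _.
    by apply: subset_card_le => v [].
  have [m Bm mP] := wf_minimal wfD (ex_intro _ d bd).
  by rewrite rE; apply: (xgetPex d0 (ex_intro _ m _)).
exists r => v w cv cw vw; have [nw minw] := rP w cw; have [nv minv] := rP v cv.
have [//|rvw|] := totD (r v) (r w).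
  by case: nw; exists v.
(* By minimality of [r v], the smaller value [r w] is already taken below [v], hence below [w]. *)
move=> rwv; case: (minv _ _ rwv) => -[u [cu uv] ruw]; apply: nw.
by exists u => //; split=> //; exact: tr uv vw.
Qed.

(** * Brouwer ordinals *)

(* Brouwer ordinals: [BSup f] is the least strict upper bound of [f], so that
   bounds of I-indexed families need no cardinal arithmetic. *)
Inductive brouwer (I : Type) : Type := BZero | BSup of (I -> brouwer I).
Arguments BZero {I}.

Fixpoint ble (I : Type) (x y : brouwer I) : Prop :=
  if x is BSup f then
    forall i, if y is BSup g then exists j, ble (f i) (g j) else False
  else True.

Definition blt (I : Type) (x y : brouwer I) : Prop :=
  if y is BSup g then exists j, ble x (g j) else False.

Lemma ble_refl (I : Type) (x : brouwer I) : ble x x.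
Proof. by elim: x => //= f IH i; exists i. Qed.

Lemma ble_trans (I : Type) (y x z : brouwer I) : ble x y -> ble y z -> ble x z.
Proof.
elim: x y z => // f IH [|g] [|h] // xy yz i; have // [j fg] := xy i.
by have [k gh] := yz j; exists k; exact: IH fg gh.
Qed.

Lemma ble_blt_trans (I : Type) (y x z : brouwer I) :
  ble x y -> blt y z -> blt x z.
Proof. by case: z => //= h xy [k yh]; exists k; exact: ble_trans xy yh. Qed.

Lemma blt_ble_trans (I : Type) (y x z : brouwer I) :
  blt x y -> ble y z -> blt x z.
Proof.
by case: y => //= g [j xg] /(_ j) gz; exact: (@ble_blt_trans _ (g j)).
Qed.

Lemma bltW (I : Type) (x y : brouwer I) : blt x y -> ble x y.
Proof.
elim: x y => //= f IH [|g] //= [j fg] i; exists j.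
by apply: IH; exact: fg i.
Qed.

(** The two dichotomies need one joint induction: the first for [BSup f] uses the second for each
    [f i], and the second follows from the first applied to the branches of [y]. *)
Lemma ble_total (I : Type) (x y : brouwer I) :
  (ble x y \/ blt y x) /\ (blt x y \/ ble y x).
Proof.
elim: x y => [|f IHx] y.
  split; first by left.
  case: y => [|g]; first by right.
  have [[i _]|nI] := pselect (exists i : I, True); first by left; exists i.
  by right=> i; case: nI; exists i.
suff le_or y' : ble (BSup f) y' \/ blt y' (BSup f).
  split; first exact: le_or.
  case: y => [|g]; first by right.
  have [|nj] := pselect (exists j, ble (BSup f) (g j)); first by left.
  right=> j; have [fg|//] := le_or (g j); by case: nj; exists j.
have [|/existsNP[i nfi]] := pselect (forall i, blt (f i) y'); first by left.
by right; exists i; have [_ []] := IHx i y'.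
Qed.

Lemma wf_blt (I : Type) : well_founded (@blt I).
Proof.
suff bAcc (x y : brouwer I) : ble y x -> Acc (@blt I) y.
  by move=> x; exact: bAcc (ble_refl x).
elim: x y => [|f IH] y yx; constructor => z zy.
  by have := blt_ble_trans zy yx.
by have [i] := blt_ble_trans zy yx; exact: IH.
Qed.

Lemma nble_blt (I : Type) (x y : brouwer I) : ~ ble x y -> blt y x.
Proof. by have [[]] := ble_total x y. Qed.

Lemma exists_bounded_order (I : Type) : exists (W : Type)
    (lt : W -> W -> Prop) (bound : (I -> W) -> W) (w0 : W),
  weak_well_order lt /\ forall u i, lt (u i) (bound u).
Proof.
exists (brouwer I), (@blt I), (@BSup I), BZero; split; last first.
  by move=> u i; exists i; exact: ble_refl.
split=> [|x y z xy yz|x y z xz]; first exact: wf_blt.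
  exact: ble_blt_trans (bltW xy) yz.
have [|nyx] := pselect (ble y x); last by left; exact: nble_blt.
by move=> yx; right; exact: ble_blt_trans yx xz.
Qed.

(** * Countably complete ultrafilters and their ultrapowers *)

Definition omega1_ultra (T : Type) (p : set_system T) : Prop :=
  UltraFilter p /\ omega1_filter_complete p.

Lemma omega1_bigcap (T : Type) (I : countType) (p : set_system T)
    (A : I -> set T) :
  omega1_filter_complete p -> (forall i, p (A i)) -> p (\bigcap_i A i).
Proof.
move=> cp pA; rewrite -(bigcap_image setT A id); apply: cp => [_ [i _ <-]//|].
exact: card_le_trans (card_image_le _ _) (countableP _).
Qed.

Lemma ultra_fmap (S T : Type) (f : S -> T) (p : set_system S) :
  UltraFilter p -> UltraFilter (fmap f p).
Proof.
move=> up; split; first exact: fmap_proper_filter.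
move=> G GG pG; apply/seteqP; split=> // A GA.
have [//|nA] := in_ultra_setVsetC (f @^-1` A) up.
have /pG GnA : fmap f p (~` A) by [].
by have [x []] := filter_ex (filterI GA GnA).
Qed.

Lemma omega1_ultra_fmap (S T : Type) (f : S -> T) (p : set_system S) :
  omega1_ultra p -> omega1_ultra (fmap f p).
Proof.
move=> [up cp]; split; first exact: ultra_fmap.
move=> E Ep cE; rewrite /fmap/= preimage_bigcap -(bigcap_image E _ id).
apply: cp => [_ [A /Ep pA <-]//|].
exact: card_le_trans (card_image_le _ _) cE.
Qed.

(** By countable completeness, a sequence descending modulo [U] descends pointwise at some [s]. *)
Lemma wf_ultrapower (S W : Type) (lt : W -> W -> Prop) (U : set_system S) :
  omega1_ultra U -> well_founded lt ->
  well_founded (fun g h : S -> W => U [set s | lt (g s) (h s)]).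
Proof.
move=> [uU cU] wf g; apply: contrapT => ng.
have [u _ du] := not_Acc_descent ng.
have [s us] := filter_ex (omega1_bigcap cU du).
by apply: (@wf_no_descent _ _ (u^~ s) wf) => n; exact: us.
Qed.

(* [Q s] is the segment below [g s], where [g] is least modulo [U] above all the
   constants, and all of W if there is no such [g]. *)
Lemma ultra_initial_segment (S W : Type) (lt : W -> W -> Prop)
    (U : set_system S) : omega1_ultra U -> well_founded lt ->
  exists2 Q : S -> set W, forall w, U [set s | Q s w] &
    forall d : S -> W, U [set s | Q s (d s)] ->
      exists w, U [set s | ~ lt w (d s)].
Proof.
move=> oU wf; have [uU cU] := oU.
pose above : set (S -> W) := [set g | forall w, U [set s | lt w (g s)]].
have not_above (d : S -> W) : ~ above d -> exists w, U [set s | ~ lt w (d s)].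
  move=> /existsNP[w nw]; exists w.
  by have [//|] := in_ultra_setVsetC [set s | lt w (d s)] uU.
have [ne|nne] := pselect (above !=set0).
  have [g ag gP] := wf_minimal (wf_ultrapower oU wf) ne.
  exists (fun s w => lt w (g s)) => [w|d dg]; first exact: ag.
  by apply: not_above => /gP.
exists (fun=> setT) => [w|d _]; first exact: filterT.
by apply: not_above => ad; apply: nne; exists d.
Qed.

(** * Tame sets and a fine ultrafilter on them *)

(* Unlike |x| < |D|, this is stable under unions of fewer than |D| sets even
   when |D| is singular. *)
Definition tame (D W : Type) (lt : W -> W -> Prop) (x : set W) : Prop :=
  forall y, y `<=` x -> exists c,
    [/\ c `<=` y, card_lt c [set: D] &
        forall w, y w -> exists2 v, c v & ~ lt v w].

Lemma countable_card_lt (D W : Type) (c : set W) :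
  ~ countable [set: D] -> countable c -> card_lt c [set: D].
Proof.
move=> ncD cc; split; last by move=> /card_le_trans/(_ cc).
apply: card_le_trans cc _; apply/infiniteP => fD; apply: ncD.
exact: finite_set_countable.
Qed.

Lemma card_lt_image (D T W : Type) (f : T -> W) (E : set T) :
  card_lt E [set: D] -> card_lt (f @` E) [set: D].
Proof.
move=> [ED nDE]; split; first exact: card_le_trans (card_image_le _ _) ED.
by move=> DfE; apply: nDE; exact: card_le_trans DfE (card_image_le _ _).
Qed.

Lemma tame1 (D W : Type) (lt : W -> W -> Prop) (w : W) :
  ~ countable [set: D] -> well_founded lt -> tame D lt [set w].
Proof.
move=> ncD wf y yw; exists y; split=> // [|v yv].
  apply: countable_card_lt => //.
  exact: sub_countable (subset_card_le yw) (countable1 _).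
by exists v => //; exact: wf_irrefl.
Qed.

(** Either some [c A] is cofinal in all of [y], or each [c A] has a strict upper bound [u A] in [y];
    the fewer than |D| points [u A] are then cofinal. *)
Lemma tame_bigcup (D W T : Type) (lt : W -> W -> Prop) (E : set T)
    (x : T -> set W) : ~ countable [set: D] -> weak_well_order lt ->
  card_lt E [set: D] ->
  (forall A, E A -> tame D lt (x A)) -> tame D lt (\bigcup_(A in E) x A).
Proof.
move=> ncD [_ tr _] ED tx y yx.
have [->|/set0P[w0 _]] := eqVneq y set0.
  exists set0; split=> //; apply: countable_card_lt => //; exact: countable0.
have /choice[c cP] A : exists c, E A ->
    [/\ c `<=` y `&` x A, card_lt c [set: D] &
      forall w, (y `&` x A) w -> exists2 v, c v & ~ lt v w].
  have [EA|nEA] := pselect (E A); last by exists set0.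
  have [c cP] := tx A EA (y `&` x A) (@subIsetr _ _ _).
  by exists c.
pose cofinal A := forall w, y w -> exists2 v, c A v & ~ lt v w.
have [[A EA cofA]|ncof] := pselect (exists2 A, E A & cofinal A).
  have [cy cD _] := cP A EA; exists (c A); split=> // v /cy[].
  by [].
have /choice[u uP] A : exists u, E A ->
    y u /\ forall v, c A v -> lt v u.
  have [EA|nEA] := pselect (E A); last by exists w0.
  have /existsNP[w /not_implyP[yw nw]] : ~ cofinal A.
    by move=> cofA; apply: ncof; exists A.
  exists w => _; split=> // v cv; apply: contrapT => nvw.
  by apply: nw; exists v.
exists (u @` E); split=> [_ [A EA <-]||w yw]; first by have [] := uP A EA.
  exact: card_lt_image.
have [A EA xw] := yx w yw; exists (u A); first by exists A.
have [_ _ /(_ w (conj yw xw)) [v cv nvw]] := cP A EA.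
by move=> uw; apply: nvw; apply: tr uw; have [_] := uP A EA; exact.
Qed.

(** The cones of tame supersets of a tame set generate a filter, which is |D|-complete because tame
    sets are closed under unions of fewer than |D| members. *)
Lemma fine_tame_ultrafilter (D W : Type) (lt : W -> W -> Prop) :
  omega1_strongly_compact D -> weak_well_order lt ->
  exists U : set_system (set W), [/\ omega1_ultra U, U (tame D lt) &
    forall w, U [set x | x w]].
Proof.
move=> [ncD strongD] wo; have [wf _ _] := wo.
pose F : set_system (set W) := [set A | exists2 x, tame D lt x &
  forall y, x `<=` y -> tame D lt y -> A y].
have Fcap (E : set_system (set W)) : E `<=` F -> card_lt E [set: D] ->
    F (\bigcap_(A in E) A).
  move=> EF ED.
  have /choice[x xP] (A : set (set W)) : exists x, E A ->
      tame D lt x /\ forall y, x `<=` y -> tame D lt y -> A y.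
    have [/EF[x tx xA]|nEA] := pselect (E A).
      by exists x.
    by exists set0.
  exists (\bigcup_(A in E) x A).
    by apply: tame_bigcup => // A /xP[].
  move=> y xy ty A EA; have [_] := xP A EA; apply=> //.
  exact: subset_trans (bigcup_sup EA) xy.
have FT (A : set (set W)) : tame D lt `<=` A -> F A.
  move=> tA; exists set0 => [|y _ /tA//] y y0; exists set0; split=> //.
    by apply: countable_card_lt => //; exact: countable0.
  by move=> w /y0.
have FF : ProperFilter F.
  split; first by move=> [x tx /(_ x)]; apply.
  have FS A B : A `<=` B -> F A -> F B.
    by move=> AB [x tx xA]; exists x => // y xy ty; exact/AB/xA.
  split=> // [|A B FA FB]; first exact: FT.
  apply: (FS (\bigcap_(C in [set A; B]) C)).
    by move=> x ABx; split; apply: ABx; [left|right].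
  apply: Fcap => [C [->|->]//|]; apply: countable_card_lt => //.
  exact/finite_set_countable.
have [U [uU FU cU]] := strongD _ F FF Fcap.
exists U; split=> // [|w]; first exact/FU/FT.
apply: FU; exists [set w]; first exact: tame1.
by move=> y wy _; exact: wy.
Qed.

(** * The slowed ultrapower *)

(* For tame [x], choose a cofinal subset [c x] of [x `&` Q x] with fewer than
   |D| elements; [f w x] is the rank, in [c x], of its least element not below
   [w]. By the minimality of [Q], this element does not exceed [next w]. *)
Lemma slowed_ultrapower (D : choiceType) (ltD : D -> D -> Prop) (d0 : D)
    (W : Type) (lt : W -> W -> Prop) :
  omega1_strongly_compact D -> weak_well_order ltD ->
  (forall x y, [\/ ltD x y, x = y | ltD y x]) -> weak_well_order lt ->
  exists (S : Type) (U : set_system S) (f : W -> S -> D) (next : W -> W),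
    omega1_ultra U /\
    forall v w, lt (next v) w -> U [set s | ltD (f v s) (f w s)].
Proof.
move=> scD woD totD wo; have [wf tr ntr] := wo.
have [U [oU tameU fineU]] := fine_tame_ultrafilter scD wo.
have [uU cU] := oU.
have [Q QU Qnext] := ultra_initial_segment oU wf.
have /choice[c cP] x : exists c, tame D lt x ->
    [/\ c `<=` x `&` Q x, card_lt c [set: D] &
      forall w, (x `&` Q x) w -> exists2 v, c v & ~ lt v w].
  have [tx|] := pselect (tame D lt x); last by exists set0.
  by have [c cP] := tx _ (@subIsetl _ x (Q x)); exists c.
have /choice[r rP] x : exists r : W -> D, tame D lt x ->
    forall v w, c x v -> c x w -> lt v w -> ltD (r v) (r w).
  have [tx|] := pselect (tame D lt x); last first.
    by exists (fun=> d0).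
  have [_ [_ ncx] _] := cP x tx.
  by have [r rP] := rank_embedding d0 woD totD wo ncx; exists r.
pose least x w v :=
  [/\ c x v, ~ lt v w & forall u, c x u -> ~ lt u w -> ~ lt u v].
have /choice[d dP] w : exists d : set W -> W, forall x,
    tame D lt x -> x w -> Q x w -> least x w (d x).
  suff /choice[d dP] x : exists v,
    tame D lt x -> x w -> Q x w -> least x w v by exists d.
  have [[tx xw Qw]|nh] := pselect [/\ tame D lt x, x w & Q x w]; last first.
    by exists w => tx xw Qw; case: nh.
  have [_ _ /(_ w (conj xw Qw)) [v0 cv0 v0w]] := cP x tx.
  have [v [cv vw] vmin] := wf_minimal (A := [set v | c x v /\ ~ lt v w]) wf
    (ex_intro _ v0 (conj cv0 v0w)).
  by exists v => _ _ _; split=> // u cu uw; exact: vmin.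
have dU w : U [set x | tame D lt x /\ least x w (d w x)].
  apply: filterS (filterI tameU (filterI (fineU w) (QU w))) => x [tx [xw Qw]].
  by split=> //; exact: dP.
(* Almost everywhere [d w x] lies in [Q x], so [d w] does not dominate all the constants. *)
have /choice[next nextP] w : exists v, U [set x | ~ lt v (d w x)].
  apply: Qnext.
  by apply: filterS (dU w) => x [tx [cd _ _]]; have [/(_ _ cd)[]] := cP x tx.
exists (set W), U, (fun w x => r x (d w x)), next; split=> // v w nvw.
apply: filterS (filterI (nextP v) (filterI (dU v) (dU w))).
move=> x [ndv [[tx [cv _ _]] [_ [cw nw _]]]].
apply: rP => //.
(* In the weak order, [d v x] is at most [next v], which is below [w], which is at most [d w x]. *)
have [/ndv//|dvw] := ntr _ (d v x) _ nvw.
by have [|/nw] := ntr _ (d w x) _ dvw.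
Qed.

(** * The coherent tower of ultrafilters *)

Lemma omega1_ultra_principal (T : Type) (x : T) :
  omega1_ultra (principal_filter x).
Proof.
split; first exact: principal_filter_ultra.
by move=> E Ex _; apply/principal_filterP => A /Ex/principal_filterP.
Qed.

(* Lists are stored newest entry first, so that truncation is [behead] and a
   descending sequence is an increasingly sorted list. *)
Lemma descending_tower (D : choiceType) (ltD : D -> D -> Prop) (d0 : D) :
  omega1_strongly_compact D -> weak_well_order ltD ->
  (forall x y, [\/ ltD x y, x = y | ltD y x]) ->
  exists p : nat -> set_system (seq D), forall n,
    [/\ omega1_ultra (p n), p n [set l | sorted (fun x y => `[< ltD x y >]) l],
      fmap behead (p n.+1) = p n & p n [set l | size l = n]].
Proof.
move=> scD woD totD; pose e x y := `[< ltD x y >].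
pose node (p : set_system (seq D)) := omega1_ultra p /\ p [set l | sorted e l].
pose child (q p : set_system (seq D)) :=
  [/\ node q, fmap behead q = p & q [set l | l <> [::]]].
pose root : set_system (seq D) := principal_filter [::].
have noderoot : node root.
  by split; [exact: omega1_ultra_principal|exact/principal_filterP].
have [Aroot|nroot] := pselect (Acc child root); last first.
  have [p p0 pS] := not_Acc_descent nroot; exists p => n.
  have [op sp] : node (p n) by case: n => [|n]; [rewrite p0|case: (pS n)].
  split=> //; first by have [] := pS n.
  elim: n {op sp} => [|n IH]; first by rewrite p0; exact/principal_filterP.
  have [[[? _] _] bp pn0] := pS n; move: IH; rewrite -bp /fmap/= => IH.
  by apply: filterS (filterI IH pn0) => -[|x l] [/= <-].
exfalso.
have [W [lt [bound [w0 [wo boundP]]]]] :=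
  exists_bounded_order (set_system (seq D)).
have [S [U [f [next [oU fU]]]]] := slowed_ultrapower d0 scD woD totD wo.
have [uU _] := oU.
(* Restricting to accessible parents makes the relation well-founded on all set systems, so that
   [psi] can be defined everywhere; [w0] fills the indices that are not children. *)
pose child' q p := child q p /\ Acc child p.
have wfc : well_founded child'.
  move=> p; have [Ap|nAp] := pselect (Acc child p); last first.
    by constructor => q [].
  by elim: Ap => {}p _ IH; constructor => q [qp _]; exact: IH.
have [psi psiE] : exists psi : set_system (seq D) -> W, forall p,
    psi p = bound (fun q => if pselect (child' q p) then next (psi q) else w0).
  apply: (wf_recursion (G := fun p h =>
    bound (fun q => if pselect (child' q p) then next (h q) else w0)) w0 wfc).
  move=> p h h' hh'; congr bound; apply/funext => q.
  by case: pselect => // qp; rewrite (hh' _ qp).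
have psiP q p : child q p -> Acc child p -> lt (next (psi q)) (psi p).
  move=> qp Ap; rewrite (psiE p).
  have := boundP (fun q => if pselect (child' q p) then next (psi q) else w0) q.
  case: pselect => // ncq; by case: ncq.
pose tp ws := fmap (fun s => [seq f w s | w <- ws]) U.
(* Invariant: [p] is the distribution of the values at [ws], and [psi p] may be put in front of [ws]
   without breaking descent. This always produces a child of [p], which accessibility forbids. *)
suff noacc p : Acc child p -> forall ws, tp ws = p -> node p ->
    (if ws is w :: _ then U [set s | ltD (f (psi p) s) (f w s)] else True) ->
    False.
  apply: (noacc root Aroot [::]) => //.
  apply/seteqP; split=> A; rewrite /tp /fmap /=.
    by move=> pA; have [s As] := filter_ex pA; exact/principal_filterP.
  by move=> /principal_filterP A0; exact: filterE.
elim=> {}p aP IH ws wsp [op sp] ltws.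
have Ap : Acc child p by constructor.
pose ws' := psi p :: ws.
have cp : child (tp ws') p.
  split=> //; last by apply: (@filterE _ U).
  split; first exact: omega1_ultra_fmap.
  move: sp ltws; rewrite -{1}wsp /tp /fmap /ws' /=.
  case: ws {wsp ws'} => [_ _|w ws sp ltws]; first exact: filterE.
  apply: filterS (filterI sp ltws) => s /= [ps lts].
  by apply/andP; split=> //; exact/asboolP.
by apply: (IH _ cp ws' erefl) => //; [case: cp|exact/fU/psiP].
Qed.

(** * Entourages of the product uniformity *)

Lemma entourage_sup (T : choiceType) (I : Type) (Tc : I -> Uniform T) (i : I)
    (V : set (T * T)) : @entourage (Uniform.Pack (Tc i)) V ->
  @entourage (sup_topology Tc) V.
Proof.
move=> iV; have /asboolP iV' := iV.
pose B : {p : {classic I} * set (T * T) |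
  `[< @entourage (Uniform.Pack (Tc p.1)) p.2 >]} := exist _ (i, V) iV'.
exists V => //; exists [fset B]%fset; first by move=> ? ?; exact: in_setT.
apply/seteqP; split=> [xy /(_ B)|xy Vxy p /=]; last by rewrite inE => /eqP ->.
by apply; rewrite /= inE.
Qed.

Lemma entourage_sup_sub (T : choiceType) (I : Type) (Tc : I -> Uniform T)
    (P : set_system (T * T)) : Filter P ->
  (forall i V, @entourage (Uniform.Pack (Tc i)) V -> P V) ->
  forall V, @entourage (sup_topology Tc) V -> P V.
Proof.
move=> FP iP V [B [F _ <-] BV]; apply: (filterS BV); apply: filter_bigI => p _.
by case: p => -[i A] /= /asboolP; exact: iP.
Qed.

Lemma entourage_baire_coord (D : choiceType) (K : Type) (k : K) :
  @entourage (baire_space D K) [set xy | xy.1 k = xy.2 k].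
Proof.
apply: (@entourage_sup _ _ (fun i : K => Uniform.class
  (initial_topology (@proj K (fun=> discrete_topology D) i))) k).
exists [set xy | xy.1 = xy.2] => //.
have -> : @entourage (discrete_topology D) = discrete_ent.
  exact: uniform_discrete.
by move=> _ [d _ <-].
Qed.

(** Only finitely many coordinates matter to [V]. Demanding agreement at all coordinates except the
    [iota i] with [n <= i] covers them once [n] is large. *)
Lemma entourage_baire_agree (D : choiceType) (K : Type) (iota : nat -> K)
    (V : set (baire_space D K * baire_space D K)) :
  injective iota -> entourage V ->
  exists n, forall x y : baire_space D K,
    (forall k, (forall i, (n <= i)%N -> iota i <> k) -> x k = y k) -> V (x, y).
Proof.
move=> inj_iota.
pose P (V : set (baire_space D K * baire_space D K)) :=
  exists n, forall x y : baire_space D K,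
    (forall k, (forall i, (n <= i)%N -> iota i <> k) -> x k = y k) -> V (x, y).
apply: (@entourage_sup_sub _ _ (fun i : K => Uniform.class
  (initial_topology (@proj K (fun=> discrete_topology D) i))) P).
  split=> [|A B [n nA] [m mB]|A B AB [n nA]]; first by exists 0%N.
    exists (maxn n m) => x y xy; split; [apply: nA|apply: mB] => k kP;
      by apply: xy => i; rewrite geq_max => /andP[? ?]; exact: kP.
  by exists n => x y /nA /AB.
move=> k A [B entB BA].
have diagB : discrete_ent B by rewrite -uniform_discrete.
have [[j jk]|nk] := pselect (exists j, iota j = k).
  exists j.+1 => x y xy; apply: BA; apply: diagB; exists (x k) => //.
  congr pair; apply: xy => i ji ik; move: ji.
  by rewrite (inj_iota i j) ?ltnn // ik jk.
exists 0%N => x y xy; apply: BA; apply: diagB; exists (x k) => //.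
by congr pair; apply: xy => i _ ik; apply: nk; exists i.
Qed.

(** * Convergence in the Samuel realcompactification *)

(** The second hypothesis makes [P] Cauchy for the weak uniformity, so [P] converges to a point of
    the completion. A continuous extension is bounded near that point, whereas [g] is unbounded
    along [P]. *)
Lemma samuel_no_extension (R : realType) (X : uniformType) (g : X -> R)
    (P : set_system X) : ProperFilter P ->
  (forall f : X -> R, unif_continuous f -> forall e : R, 0 < e ->
    exists c, P [set x | `|f x - c| < e]) ->
  (forall r, P [set x | r < g x]) ->
  ~ exists h : samuel_realcompactification R X -> R,
      continuous h /\ forall x, h (to_samuel R x) = g x.
Proof.
move=> PP cauP unbP [h [ch hg]].
have cP : @cauchy (weak_uniformity R X) P.
  apply/cauchy_smallP; apply: entourage_sup_sub.
    split=> [|A B [M PM MA] [N PN NB]|A B AB [M PM MA]].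
    - by exists setT => //; exact: filterT.
    - exists (M `&` N); first exact: filterI.
      by move=> xy [[? ?] [? ?]]; split; [exact: MA|exact: NB].
    - by exists M => // xy /MA /AB.
  move=> [f uf] A [B]; rewrite -entourage_ballE => -[e /= e0 eB] BA.
  have [c Pc] : exists c, P [set x | `|f x - c| < e / 2].
    by apply: cauP => //; exact: divr_gt0.
  exists [set x | `|f x - c| < e / 2] => // -[x y] [/= xc yc].
  apply: BA; apply: eB => /=; rewrite /ball /=.
  rewrite (splitr e); apply: le_lt_trans (ler_distD c _ _) _.
  by apply: ltrD => //; rewrite distrC.
have [F FP] := @minimal_cauchy_below (weak_uniformity R X) P PP cP.
have /nbhsP[E [V entV VE] Eh] : nbhs F (h @^-1` ball (h F) 1).
  by apply: ch; exact: nbhsx_ballx.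
have entW := entourage_split_ent entV; have entS := entourage_invI entW.
have [M FM MS] := completion_small F entS.
have /filter_ex[x [Mx gx]] : P (M `&` [set x | h F + 1 < g x]).
  by apply: filterI => //; exact: FP.
have : ball (h F) 1 (h (@to_samuel R X x)).
  apply/Eh/xsectionP/VE.
  exists (xsection (split_ent V `&` (split_ent V)^-1%relation) x).
  split=> /=.
  - have FF := completion_proper F.
    by apply: filterS FM => y My; apply/xsectionP/MS.
  - exact: (@nbhs_entourage (weak_uniformity R X)).
  - move=> [a b] [/= /xsectionP[_ ax] /xsectionP[xb _]].
    exact: (@entourage_split _ x).
rewrite /ball /= hg distrC => /ltr_distlDr.
by move=> /(lt_trans gx); rewrite ltxx.
Qed.

(** The countably many balls of radius [e] about the integer multiples of [e] cover the line, so one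
    of them has its preimage in [p]. *)
Lemma omega1_ultra_small (R : realType) (T : Type) (p : set_system T)
    (h : T -> R) (e : R) : omega1_ultra p -> 0 < e ->
  exists c, p [set t | `|h t - c| < e].
Proof.
move=> [up cp] e0; apply: contrapT => nc.
pose close z := [set t | `|h t - e * z%:~R| < e].
have /(omega1_bigcap cp) : forall z : int, p (~` close z).
  move=> z; have [pz|//] := in_ultra_setVsetC (close z) up.
  by case: nc; exists (e * z%:~R).
move=> /filter_ex[t /(_ (Num.floor (h t / e)) I)]; apply.
have /andP[zle ltz] := floor_itv (h t / e).
rewrite /close /= -[X in `|X - _|](divfK (lt0r_neq0 e0)) [_ * e]mulrC -mulrBr.
rewrite normrM gtr0_norm // gtr_pMr // ger0_norm ?subr_ge0 //.
by rewrite ltrBlDl; move: ltz; rewrite intrD.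
Qed.

(** * Sequences as points of the Baire space *)

Definition place (D K : Type) (d0 : D) (iota : nat -> K) (u : nat -> D)
    (k : K) : D :=
  if pselect (exists i, iota i = k) is left ik then u (projT1 (cid ik)) else d0.

Lemma place_iota (D K : Type) (d0 : D) (iota : nat -> K) (u : nat -> D) i :
  injective iota -> place d0 iota u (iota i) = u i.
Proof.
move=> inj; rewrite /place; case: pselect => [ik|]; last by case; exists i.
by case: cid => j /= /inj ->.
Qed.

Lemma eq_place (D K : Type) (d0 : D) (iota : nat -> K) (u v : nat -> D) n k :
  (forall i, (i < n)%N -> u i = v i) ->
  (forall i, (n <= i)%N -> iota i <> k) ->
  place d0 iota u k = place d0 iota v k.
Proof.
move=> uv nk; rewrite /place; case: pselect => // ik; case: cid => i /= ei.
by apply: uv; rewrite ltnNge; apply/negP => /nk.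
Qed.

Lemma entourage_baire_prefix (D : choiceType) (K : Type) (iota : nat -> K) n :
  @entourage (baire_space D K)
    [set xy | forall i, (i < n)%N -> xy.1 (iota i) = xy.2 (iota i)].
Proof.
have FE := @entourage_filter (baire_space D K).
elim: n => [|n IH]; first by apply: (@filterE _ _ FE) => -[x y] i.
apply: (@filterS _ _ FE) (@filterI _ _ FE _ _ IH
  (entourage_baire_coord D (iota n))) => -[x y] /=.
by move=> [xy xyn] i; rewrite ltnS leq_eqVlt => /orP[/eqP ->|/xy].
Qed.

Lemma first_ascent (D : Type) (ltD : D -> D -> Prop) : well_founded ltD ->
  exists b : (nat -> D) -> nat, forall u,
    ~ ltD (u (b u).+1) (u (b u)) /\
    forall n, ~ ltD (u n.+1) (u n) -> (b u <= n)%N.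
Proof.
move=> wf; suff /choice[b bP] u : exists n, ~ ltD (u n.+1) (u n) /\
    forall m, ~ ltD (u m.+1) (u m) -> (n <= m)%N by exists b.
have /existsNP[n0 n0P] := wf_no_descent (u := u) wf.
have exP : exists n, `[< ~ ltD (u n.+1) (u n) >] by exists n0; exact/asboolP.
exists (ex_minn exP); case: ex_minnP => n /asboolP nP nmin; split=> // m mP.
by apply: nmin; exact/asboolP.
Qed.

Lemma tower_drop (D : Type) (p : nat -> set_system (seq D)) n k :
  (forall n, fmap behead (p n.+1) = p n) -> fmap (drop k) (p (k + n)%N) = p n.
Proof.
move=> pS; elim: k => [|k IH].
  by rewrite add0n [drop 0](_ : _ = id) //; apply/funext => l; rewrite drop0.
have -> : @drop D k.+1 = drop k \o behead.
  by apply/funext => -[|x l] //; case: k {IH}.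
by rewrite -[LHS]/(fmap (drop k) (fmap behead (p (k.+1 + n)%N))) addSn pS.
Qed.

(** * The function with no extendable reciprocal *)

Theorem theorem1 (R : realType) (D : choiceType) (K : Type)
  (hD : omega1_strongly_compact D) (hK : infinite_set [set: K]) :
  exists f : baire_space D K -> R,
    [/\ unif_continuous f,
        (forall x, f x != 0) &
        ~ (exists h : samuel_realcompactification R (baire_space D K) -> R,
             continuous h /\ forall x, h (to_samuel R x) = 1 / f x)].
Proof.
have [ltD woD totD] := exists_well_order D.
have [d0 _] : [set: D] !=set0.
  apply/set0P/negP => /eqP D0; case: hD => + _; apply.
  by rewrite D0; exact: countable0.
have [iota inj_iota] : exists iota : nat -> K, injective iota.
  have /infiniteP/card_leP/unsquash j := hK.
  exists (fun n => val (j (to_setT n))) => m n /val_inj.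
  by move=> /(inj (mem_setT _) (mem_setT _))/(congr1 val).
have [p pP] := descending_tower d0 hD woD totD.
have [b bP] := first_ascent (let: And3 wf _ _ := woD in wf).
pose f (x : baire_space D K) : R := (b (x \o iota)).+1%:R^-1.
exists f; split.
- move=> A; rewrite -entourage_ballE => -[e /= e0 eA].
  have [N] := ltr_add_invr e0; rewrite add0r => Ne.
  (* A failure of descent at an index at most [N] involves only the entries up to [N.+1], hence
     [N.+2] coordinates. If both failures come later, both values lie between 0 and [e]. *)
  apply: (@filterS _ _ (@entourage_filter (baire_space D K)) _ _ _
    (entourage_baire_prefix D iota N.+2)) => -[x y] /= xy.
  apply: eA => /=; rewrite /ball /= /f.
  have bN (z w : baire_space D K) :
      (forall i, (i < N.+2)%N -> z (iota i) = w (iota i)) ->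
      (b (z \o iota) <= N)%N -> (b (w \o iota) <= b (z \o iota))%N.
    move=> zw bz; have [nz _] := bP (z \o iota); have [_] := bP (w \o iota).
    by apply; move: nz; rewrite /= !zw //; apply: leqW.
  have yx i : (i < N.+2)%N -> y (iota i) = x (iota i) by move=> /xy.
  have [bx|bx] := leqP (b (x \o iota)) N.
    have byx := bN _ _ xy bx; have bxy := bN _ _ yx (leq_trans byx bx).
    have -> : b (x \o iota) = b (y \o iota) by apply/eqP; rewrite eqn_leq bxy.
    by rewrite subrr normr0.
  have by' : (N < b (y \o iota))%N.
    rewrite ltnNge; apply/negP => byN.
    by have := leq_trans (bN _ _ yx byN) byN; rewrite leqNgt bx.
  have small n : (N < n)%N -> 0 < (n.+1%:R^-1 : R) < e.
    move=> Nn; rewrite invr_gt0 ltr0Sn /=; apply: le_lt_trans Ne.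
    by rewrite lef_pV2 ?posrE ?ltr0Sn // ler_nat ltnW.
  move: (small _ bx) (small _ by'); move: (_^-1) (_^-1) => a b'.
  by move=> /andP[? ?] /andP[? ?]; rewrite ltr_norml; lra.
- by move=> x; rewrite invr_eq0 pnatr_eq0.
(* The reversal puts the oldest entry at [iota 0]; truncating a list then alters only late
   coordinates. *)
pose E (l : seq D) : baire_space D K := place d0 iota (nth d0 (rev l)).
pose P : set_system (baire_space D K) :=
  fun A => \forall n \near \oo, p n (E @^-1` A).
have PP : ProperFilter P.
  have pF n : ProperFilter (p n).
    by have [[up _] _ _ _] := pP n; exact: ultra_proper.
  split.
    move=> P0; have [n] := filter_ex (P0 : \forall n \near \oo, p n set0).
    exact: (@filter_not_empty _ (p n)).
  split; first by exists 0%N => // n _; exact: (@filterT _ (p n)).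
  - move=> A B [n _ nA] [m _ mB]; exists (maxn n m) => // k /=.
    by rewrite geq_max => /andP[/nA ? /mB ?]; exact: (@filterI _ (p k)).
  - by move=> A B AB [n _ nA]; exists n => // k /nA; apply: filterS => l /AB.
apply: (samuel_no_extension PP) => [g ug e e0|r].
  have e2 : 0 < e / 2 by exact: divr_gt0.
  have /(entourage_baire_agree inj_iota)[n nV] : entourage
      [set xy : baire_space D K * baire_space D K |
        ball (g xy.1) (e / 2) (g xy.2)].
    have /ug : @entourage R [set ab | ball ab.1 (e / 2) ab.2].
      by apply: (entourage_ball _ (PosNum e2)).
    by [].
  have [op _ _ _] := pP n.
  have [c pc] := omega1_ultra_small (g \o E) op e2.
  exists c; exists n => // m /= nm.
  have [[? _] _ _ sizem] := pP m.
  have : p n [set t | `|(g \o E) t - c| < e / 2] by [].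
  (* Coherence transfers the estimate from [p n] to [p m] by dropping the [m - n] newest entries,
     which changes [g] by less than [e / 2]. *)
  rewrite -(@tower_drop _ p n (m - n)); last by move=> j; have [] := pP j.
  rewrite subnK // /fmap /= => pdrop.
  apply: filterS (filterI sizem pdrop) => l /= [szl ltl].
  rewrite (splitr e).
  apply: le_lt_trans (ler_distD (g (E (drop (m - n) l))) _ _) _.
  apply: ltrD => //; apply: (nV (E l) (E (drop (m - n) l))) => k kP.
  apply: eq_place kP => i iin.
  by rewrite rev_drop szl subKn // nth_take.
have rN := le_lt_trans (ler_norm r) (archi_boundP (normr_ge0 r)).
set N := Num.bound _ in rN.
(* A descending list of length [m > N] has no failure at an index [i] with [i.+1 < m], so the
   reciprocal is at least [N], which exceeds [r]. *)
exists N.+1 => // m /= Nm; have [[? _] sorted_m _ size_m] := pP m.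
apply: filterS (filterI sorted_m size_m) => l /= [sl szl].
rewrite /f div1r invrK; apply: lt_le_trans rN _; rewrite ler_nat.
rewrite leqNgt; apply/negP => bN.
have [nb _] := bP (E l \o iota); apply: nb => /=.
rewrite /E !place_iota //.
move: (b _) bN => i iN.
have im : (i.+1 < m)%N by rewrite (leq_trans _ Nm) // ltnS ltnW.
rewrite !nth_rev ?szl //; last exact: ltnW.
(* Entry [i.+1] of the reversed list is entry [m - i.+2] of [l], and entry [i] is the next one. *)
move/(sortedP d0): sl => /(_ (m - i.+2)%N); rewrite szl subnSK // => sP.
by apply/asboolP/sP; rewrite ltn_subrL (leq_ltn_trans _ im).
Qed.
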